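(* Let $X^s_p$, $Y^s_p$ and the mappings $A$ and $\mathcal N$ be given such that conditions (I)–(V) listed in the context are satisfied. (1) For every $u\in X^{s_0}_{p_0}$ with $(s_0,p_0)\in\mathbb D(A)\cap\mathbb D(\mathcal N)$, the parametrix $P^{(N)}=\sum_{k=0}^{N-1}(\widetilde A B_u)^k$ is for every $N\in\mathbb N$ a linear operator $$P^{(N)}\colon X^s_p\to X^s_p\quad\text{for all }(s,p)\in\mathbb D_u:=\mathbb D(A)\cap\mathbb D(B_u).$$ And for every $(s',p'),(s'',p'')\in\mathbb D_u$ there exists $N'\in\mathbb N$ such that $(\widetilde AB_u)^N$ is a linear map $X^{s'}_{p'}\to X^{s''}_{p''}$ for all $N\ge N'$. (2) If $u\in X^{s_0}_{p_0}$ with $(s_0,p_0)\in\mathbb D(A)\cap\mathbb D(\mathcal N)$ solves the equation $Au+\mathcal N(u)=f$ with data $f\in Y^{t-d}_r$ for some $(t,r)\in\mathbb D_u$, then for every $N\in\mathbb N$ one has the parametrix formula $$u=P^{(N)}(\widetilde Af+\mathcal Ru)+(\widetilde AB_u)^Nu,$$ and consequently $u\in X^t_r$ too.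
   Context: $n\in\mathbb N$ and $d\in\mathbb R$ are fixed numbers; $I$ denotes the identity. The conditions are: (I) Two scales $X^s_p$, $Y^s_p$ of vector spaces are given with $(s,p)$ in a common parameter set $\mathbb S\subset\mathbb R\times\,]0,\infty]$. For $(s,p),(t,r)\in\mathbb S$ (whenever the spaces written are in the scale): $X^s_p\subset X^{s-\varepsilon}_p$ when $\varepsilon>0$; $X^s_p\subset X^t_r$ when $s\ge t$ and $s-\frac np=t-\frac nr$; $X^s_p\subset X^s_r$ when $p\ge r$. (II) There is a subset (parameter domain) $\mathbb D(A)\subset\mathbb S$ and a linear map $A=A_{(s,p)}\colon X^s_p\to Y^{s-d}_p$ for each $(s,p)\in\mathbb D(A)$. For all $(s,p)\in\mathbb D(A)$ there is also a linear map $\widetilde A\colon Y^{s-d}_p\to X^s_p$ such that $\mathcal R:=I_{X^s_p}-\widetilde AA$ has range in $\bigcap_{(s,p)\in\mathbb D(A)}X^s_p$. There are vector spaces $\mathcal X\supset\bigcup_{\mathbb D(A)}X^s_p$ and $\mathcal Y\supset\bigcup_{\mathbb D(A)}Y^{s-d}_p$, and for $(s,p),(t,r)\in\mathbb D(A)$ the maps $A_{(s,p)}$ and $A_{(t,r)}$ (into $\mathcal Y$) coincide on $X^s_p\cap X^t_r$; likewise $\widetilde A$ is unambiguously defined on $Y^{s-d}_p\cap Y^{t-d}_r$. (III) There is a non-linear operator $\mathcal N$ with parameter domain $\mathbb D(\mathcal N)\subset\mathbb S$ (i.e. $\mathcal N$ is defined on $X^{s}_{p}$ for every $(s,p)\in\mathbb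 D(\mathcal N)$), which for every $(s_0,p_0)\in\mathbb D(\mathcal N)$ and every $u\in X^{s_0}_{p_0}$ has a linearisation $B_u$, i.e. $\mathcal N(u)=-B_u(u)$, where $B_u$ is a linear map $B_u\colon X^s_p\to Y^{s-d+\delta(s,p)}_p$ for every $(s,p)$ in a parameter domain $\mathbb D(B_u)\supset\mathbb D(\mathcal N)$. (The function $\delta$ may also depend on $(s_0,p_0)$.) For $(s,p),(t,r)\in\mathbb D(B_u)$ the two versions of $B_u$ coincide on $X^s_p\cap X^t_r$ (as maps into a common vector space). (IV) For $u$ as in (III), the set $\mathbb D(A)\cap\mathbb D(B_u)$ is connected with respect to the metric $\operatorname{dist}((s,p),(t,r))=\bigl((s-t)^2+(\tfrac np-\tfrac nr)^2\bigr)^{1/2}$. (V) For $u$ as in (III), the function $\delta$ satisfies $(s+\delta(s,p),p)\in\mathbb D(A)$ for every $(s,p)\in\mathbb D(A)\cap\mathbb D(B_u)$, and $\inf\{\delta(s,p):(s,p)\in K\}>0$ for every compact $K\subset\mathbb D(A)\cap\mathbb D(B_u)$. As a consequence of the consistency conditions, the subscripts $(s,p)$ on $A,\widetilde A,B_u$ are suppressed.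
   Formalization: The embeddings in (I) are assumed also for compositions of the three, with intermediate parameters allowed outside S; in (2) it is also assumed that N(u) lies in Y^{s_0-d}_{p_0}, so the equation is read in that space. Without these the claim fails. *)

(* Defs.v *)
From HB Require Import structures.
From mathcomp Require Import all_boot all_order all_algebra.
From mathcomp Require Import all_classical all_reals all_analysis.
From mathcomp Require Import ring.
Set Implicit Arguments.
Unset Strict Implicit.
Unset Printing Implicit Defensive.
Import Order.TTheory GRing.Theory Num.Theory.
Import numFieldNormedType.Exports.
Local Open Scope classical_set_scope.
Local Open Scope ring_scope.

(* Parameters (s, p).  The type is an alias, depending on n, so that it carries
   the topology of [pdist] below and not the product topology of R * \bar R.
   The constraint 0 < p is part of [embeddings]. *)
Definition param (R : realType) (n : nat) : Type := (R * \bar R)%type.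

Section Param.
Variables (R : realType) (n : nat).
Implicit Types a b c : param R n.

Definition par_s a : R := a.1.
Definition par_p a : \bar R := a.2.

(* n / p, with n / +oo = 0 *)
Definition nover (p : \bar R) : R := fine (n%:R%:E / p)%E.

Definition par_shift a (e : R) : param R n := (par_s a + e, par_p a).

Definition pdist a b : R :=
  Num.sqrt ((par_s a - par_s b) ^+ 2 + (nover (par_p a) - nover (par_p b)) ^+ 2).

Lemma pdistxx a : pdist a a = 0.
Proof. by rewrite /pdist !subrr expr0n /= addr0 sqrtr0. Qed.

Lemma pdist_sym a b : pdist a b = pdist b a.
Proof. by rewrite /pdist -[X in X ^+ 2 + _]opprB -[X in _ + X ^+ 2]opprB !sqrrN. Qed.

Lemma sqrt_sumsq_triangle (x y z t : R) :
  Num.sqrt ((x + y) ^+ 2 + (z + t) ^+ 2) <=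
  Num.sqrt (x ^+ 2 + z ^+ 2) + Num.sqrt (y ^+ 2 + t ^+ 2).
Proof.
have sq_ge0 (u v : R) : 0 <= u ^+ 2 + v ^+ 2 by rewrite addr_ge0 ?sqr_ge0.
rewrite -[leRHS]ger0_norm ?addr_ge0 ?sqrtr_ge0// -sqrtr_sqr ler_wsqrtr//.
rewrite [leRHS]sqrrD !sqr_sqrtr//.
have cs : x * y + z * t <=
    Num.sqrt (x ^+ 2 + z ^+ 2) * Num.sqrt (y ^+ 2 + t ^+ 2).
  rewrite -sqrtrM// (le_trans (ler_norm _))// -sqrtr_sqr ler_wsqrtr//.
  rewrite -subr_ge0.
  have -> : (x ^+ 2 + z ^+ 2) * (y ^+ 2 + t ^+ 2) - (x * y + z * t) ^+ 2 =
    (x * t - z * y) ^+ 2 by ring.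
  exact: sqr_ge0.
rewrite -subr_ge0 -mulr_natl; set S := (X in 2%:R * X).
have -> : x ^+ 2 + z ^+ 2 + 2%:R * S + (y ^+ 2 + t ^+ 2) -
  ((x + y) ^+ 2 + (z + t) ^+ 2) = 2%:R * (S - (x * y + z * t)) by ring.
by rewrite mulr_ge0// subr_ge0.
Qed.

Lemma pdist_triangle a b c : pdist a c <= pdist a b + pdist b c.
Proof.
rewrite /pdist; apply: le_trans (sqrt_sumsq_triangle _ _ _ _).
by rewrite !addrA !subrK.
Qed.

Definition pball a (e : R) : set (param R n) := [set b | pdist a b < e].

Lemma pball_center a (e : R) : 0 < e -> pball a e a.
Proof. by move=> e0; rewrite /pball /= pdistxx. Qed.

Lemma pball_sym a b (e : R) : pball a e b -> pball b e a.
Proof. by rewrite /pball /= pdist_sym. Qed.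

Lemma pball_triangle a b c (e1 e2 : R) :
  pball a e1 b -> pball b e2 c -> pball a (e1 + e2) c.
Proof.
rewrite /pball /= => ab bc; apply: le_lt_trans (pdist_triangle a b c) _.
exact: ltrD.
Qed.

HB.instance Definition _ := Choice.copy (param R n) (R * \bar R)%type.
HB.instance Definition _ := hasNbhs.Build (param R n) (nbhs_ (entourage_ pball)).
HB.instance Definition _ := Nbhs_isPseudoMetric.Build R (param R n)
  erefl pball_center pball_sym pball_triangle erefl.

(* Inclusions obtained from the simple, the Sobolev and the finite-measure
   embedding.  The parameters passed in a composition need not belong to the
   parameter set of the scale; only the two ends have to, see [embeddings]. *)
Inductive embeds : param R n -> param R n -> Prop :=
| embeds_simple (s e : R) (p : \bar R) : (0 < p)%E -> 0 < e ->
    embeds (s, p) (s - e, p)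
| embeds_sobolev (s t : R) (p r : \bar R) : (0 < p)%E -> (0 < r)%E ->
    t <= s -> s - nover p = t - nover r -> embeds (s, p) (t, r)
| embeds_measure (s : R) (p r : \bar R) : (0 < r)%E -> (r <= p)%E ->
    embeds (s, p) (s, r)
| embeds_trans a b c : embeds a b -> embeds b c -> embeds a c.

End Param.

Section Conditions.
Variables (R : realType) (n : nat) (d : R) (F : fieldType) (V W : lmodType F).

(* All X^s_p are subspaces of V and all Y^s_p subspaces of W; the values of the
   families X and Y outside the parameter domains are irrelevant. *)
Variables (X : param R n -> submodClosed V) (Y : param R n -> submodClosed W).

(* f restricts to a linear map E -> G; nothing is asked of f outside E.  A
   family of linear maps f_a : E_a -> G_a coinciding on the intersections
   of their domains is the same as one function f that satisfies
   [linear_between f E_a G_a] for all a (up to its values outside the E_a). *)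
Definition linear_between (U1 U2 : lmodType F) (f : U1 -> U2)
    (E : submodClosed U1) (G : submodClosed U2) : Prop :=
  (forall x, x \in E -> f x \in G) /\
  (forall (k : F) x y, x \in E -> y \in E -> f (k *: x + y) = k *: f x + f y).

Definition embeddings (S : set (param R n)) : Prop :=
  (forall a, S a -> (0 < par_p a)%E) /\
  (forall a b, S a -> S b -> embeds a b -> {subset X a <= X b}).

Definition regularising_parametrix (S DA : set (param R n))
    (A : V -> W) (At : W -> V) : Prop :=
  DA `<=` S /\
  forall a, DA a ->
    [/\ linear_between A (X a) (Y (par_shift a (- d))),
        linear_between At (Y (par_shift a (- d))) (X a) &
        forall x, x \in X a -> forall b, DA b -> x - At (A x) \in X b].

(* The domain D(B_u) and the map B_u belong to u as an element of X a0; both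
   may depend on a0. *)
Definition linearisation (S DN : set (param R n)) (NN : V -> W)
    (DB : param R n -> V -> set (param R n)) (B : param R n -> V -> V -> W)
    (delta : param R n -> param R n -> R) : Prop :=
  DN `<=` S /\
  forall a0 u, DN a0 -> u \in X a0 ->
    [/\ DN `<=` DB a0 u, DB a0 u `<=` S, NN u = - B a0 u u &
        forall a, DB a0 u a ->
          linear_between (B a0 u) (X a) (Y (par_shift a (- d + delta a0 a)))].

Definition connected_domains (DA DN : set (param R n))
    (DB : param R n -> V -> set (param R n)) : Prop :=
  forall a0 u, DN a0 -> u \in X a0 -> connected (DA `&` DB a0 u).

(* The infimum is taken in \bar R, hence is +oo for K = set0. *)
Definition delta_positive (DA DN : set (param R n))
    (DB : param R n -> V -> set (param R n))
    (delta : param R n -> param R n -> R) : Prop :=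
  forall a0 u, DN a0 -> u \in X a0 ->
    (forall a, (DA `&` DB a0 u) a -> DA (par_shift a (delta a0 a))) /\
    (forall K : set (param R n), compact K -> K `<=` DA `&` DB a0 u ->
      (0 < ereal_inf [set (delta a0 a)%:E | a in K])%E).

(* P^(N) for T = At \o B_u. *)
Definition parametrix (T : V -> V) (N : nat) (x : V) : V :=
  \sum_(k < N) iter k T x.

End Conditions.

(* Main.v *)
Require Import Defs.
From HB Require Import structures.
From mathcomp Require Import all_boot all_order all_algebra.
From mathcomp Require Import all_classical all_reals all_analysis.
From mathcomp Require Import lra.
Import Order.TTheory GRing.Theory Num.Theory.
Local Open Scope classical_set_scope.
Local Open Scope ring_scope.

(** On X^a the operator T = At B_u gains the regularity delta a > 0.  A convergent
    sequence together with its limit is compact, so the infimum condition forces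
    delta to be bounded below by a positive constant near every point of D_u;
    hence T maps X^a to X^b and X^b to X^a as soon as b is close enough to a.
    Connectedness of D_u chains these local steps into T^N : X^a' -> X^a''.
    Iterating u = (At f + R u) + T u gives the parametrix formula. *)

Section Topology.

(** If a filter on this set does not cluster at [a], one of its members misses a neighbourhood of
    [a]. Only finitely many terms lie outside that neighbourhood, so the filter lives on a finite,
    hence compact, set. *)
Lemma compact_cvg_range (T : topologicalType) (x : nat -> T) (a : T) :
  x @ \oo --> a -> compact (a |` range x).
Proof.
move=> xa G PG GK; have [ca|] := pselect (cluster G a).
  by exists a; split=> //; left.
move=> /existsNP[P] /existsNP[Q] /not_implyP[GP] /not_implyP[aQ PQ0].
have [m _ xQ] := xa _ aQ.
have : G (x @` `I_m).
  apply: filterS (filterI GP GK) => y [Py [ya|[k _ xky]]].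
    by exfalso; apply: PQ0; exists y; split=> //; rewrite ya; exact: nbhs_singleton.
  exists k => //=; rewrite ltnNge; apply/negP => mk.
  by apply: PQ0; exists y; split=> //; rewrite -xky; exact: xQ.
have /finite_compact cI := finite_image x (finite_II m).
move=> /cI[y [[k _ xky] cy]]; exists y; split=> //.
by right; exists k.
Qed.

(** Otherwise every radius 1/(k+1) yields a point of [D] that close to [a] with [g] below 1/(k+1).
    These points and their limit [a] form a compact subset of [D] on which the infimum of [g] is not
    positive. *)
Lemma locally_bounded_below (R : realType) (T : pseudoMetricType R) (D : set T)
    (g : T -> R) :
  (forall K, compact K -> K `<=` D -> (0 < ereal_inf [set (g b)%:E | b in K])%E) ->
  forall a, D a -> exists2 e : R, 0 < e &
    forall b, D b -> ball a e b -> e <= g b.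
Proof.
move=> gK a Da; apply: contrapT => /forall2NP noe.
have /choice[x xP] k : exists b, [/\ D b, ball a k.+1%:R^-1 b & g b < k.+1%:R^-1].
  have [|] := noe k.+1%:R^-1; first by rewrite invr_gt0 ltr0Sn.
  move=> /existsNP[b] /not_implyP[Db] /not_implyP[ab /negP]; rewrite -ltNge => gb.
  by exists b.
have xa : x @ \oo --> a.
  apply/cvg_ballP => e e0; near=> k.
  have [_ + _] := xP k; apply: le_ball; apply: ltW.
  by near: k; exact: near_infty_natSinv_lt (PosNum e0).
have /gK : compact (a |` range x) by exact: compact_cvg_range.
have KD : a |` range x `<=` D by move=> _ [->//|[k _ <-]]; case: (xP k).
move=> /(_ KD); set I := ereal_inf _ => I0.
have Ix k : (I < k.+1%:R^-1%:E)%E.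
  have [_ _ gx] := xP k; apply: (@le_lt_trans _ _ (g (x k))%:E); last by rewrite lte_fin.
  by apply: ereal_inf_lbound; exists (x k) => //; right; exists k.
(* Only a real [I] survives: +oo is not below 1 and -oo is not positive. *)
move: I I0 Ix => [r r0 rx| /= _ /(_ 0%N) //| //].
have [k _ /(_ k (leqnn k)) kr] := near_infty_natSinv_lt (PosNum r0).
by move: (rx k); rewrite lte_fin ltNge => /negP; apply; exact: ltW.
Unshelve. all: by end_near. Qed.

(** The points of [D] related to [a] form a nonempty, relatively clopen subset. For z near y,
    [r y z] gives openness and [r z y] closedness. *)
Lemma connected_chain (T : topologicalType) (D : set T) (r : T -> T -> Prop) :
  connected D ->
  (forall a b c, r a b -> r b c -> r a c) ->
  (forall a, D a -> exists2 U, nbhs a U & forall b, D b -> U b -> r a b /\ r b a) ->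
  forall a b, D a -> D b -> r a b.
Proof.
move=> cD rtrans rloc a b Da Db.
suff E : D `&` r a = D by have [] : (D `&` r a) b by rewrite E.
apply: cD.
(* [r] is not assumed reflexive; [r a a] holds because [a] lies in its own neighbourhood. *)
- exists a; split=> //; have [U aU /(_ a Da)[]//] := rloc a Da.
  exact: nbhs_singleton.
(* The implication admits all points outside [D], so that the set can be a neighbourhood in [T]. *)
- exists (interior [set y | D y -> r a y]); first exact: open_interior.
  apply/seteqP; split=> y [Dy]; last by move=> /nbhs_singleton /(_ Dy).
  move=> ray; split=> //; have [U yU Ur] := rloc y Dy.
  by apply: filterS yU => z Uz Dz; apply: rtrans ray _; case: (Ur z Dz Uz).
- exists (closure (D `&` r a)); first exact: closed_closure.
  apply/seteqP; split=> y [Dy].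
    by move=> ray; split=> //; exact: subset_closure.
  have [U yU Ur] := rloc y Dy.
  move=> /(_ U yU)[z [[Dz raz] Uz]]; split=> //.
  by apply: rtrans raz _; case: (Ur z Dz Uz).
Qed.

End Topology.

Section Param.
Context {R : realType} {n : nat}.
Implicit Types a b : param R n.

Lemma nover_le (p r : \bar R) : (0 < p)%E -> (p <= r)%E -> nover n r <= nover n p.
Proof.
move=> p0 pr; have r0 := lt_le_trans p0 pr.
have fin (q : \bar R) : (0 < q)%E -> (n%:R%:E / q)%E \is a fin_num.
  by move=> q0; rewrite fin_numM// fin_numV// gt_eqF// (lt_trans _ q0)// ltNy0.
apply: fine_le; rewrite ?fin//; apply: lee_wpmul2l; first by rewrite lee_fin.
by rewrite lee_pV2// inE ltW.
Qed.

(** If n/r <= n/p, a Sobolev embedding reaches integrability r at the cost n/p - n/r in s; otherwise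
    r <= p and the finite-measure embedding costs nothing. The strict inequality leaves room for a
    final simple embedding with positive loss. *)
Lemma embeds_of_lt a b : (0 < par_p a)%E -> (0 < par_p b)%E ->
  `|nover n (par_p a) - nover n (par_p b)| < par_s a - par_s b -> embeds a b.
Proof.
case: a b => [s p] [t r]; rewrite /par_p /par_s /= => p0 r0 h.
have /andP[h1 h2] : - (s - t) < nover n p - nover n r < s - t by rewrite -ltr_norml.
have down s' : t < s' -> embeds ((s', r) : param R n) ((t, r) : param R n).
  by move=> ts; rewrite -[t](subKr s'); apply: embeds_simple => //; rewrite subr_gt0.
have [rp|pr] := leP (nover n r) (nover n p).
  apply: (@embeds_trans _ _ _ (s - (nover n p - nover n r), r)).
    by apply: embeds_sobolev => //; lra.
  by apply: down; lra.
apply: (@embeds_trans _ _ _ (s, r)).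
  apply: embeds_measure => //; rewrite leNgt; apply/negP => /ltW /(nover_le p r p0).
  by rewrite leNgt pr.
by apply: down; rewrite -subr_gt0 (le_lt_trans _ h).
Qed.

Lemma pdist_ge a b : `|par_s a - par_s b| <= pdist a b /\
  `|nover n (par_p a) - nover n (par_p b)| <= pdist a b.
Proof.
by split; rewrite /pdist -sqrtr_sqr ler_wsqrtr// ?lerDl ?lerDr sqr_ge0.
Qed.

End Param.

Section LinearBetween.
Context {F : fieldType}.

Lemma linear_between_comp (U1 U2 U3 : lmodType F) (g : U1 -> U2) (f : U2 -> U3)
    (E : submodClosed U1) (G : submodClosed U2) (H : submodClosed U3) :
  linear_between g E G -> linear_between f G H -> linear_between (f \o g) E H.
Proof.
move=> [gG glin] [fH flin]; split=> [x xE|k x y xE yE] /=; first exact/fH/gG.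
by rewrite glin// flin//; exact: gG.
Qed.

Lemma linear_between_sub (U1 U2 : lmodType F) (f : U1 -> U2)
    (E : submodClosed U1) (G H : submodClosed U2) :
  {subset G <= H} -> linear_between f E G -> linear_between f E H.
Proof. by move=> GH [fG flin]; split=> // x /fG /GH. Qed.

Lemma linear_betweenD (U1 U2 : lmodType F) (f : U1 -> U2)
    (E : submodClosed U1) (G : submodClosed U2) x y :
  linear_between f E G -> x \in E -> y \in E -> f (x + y) = f x + f y.
Proof. by move=> [_ flin] xE yE; rewrite -[x in LHS]scale1r flin// scale1r. Qed.

Lemma linear_between_iter (V : lmodType F) (T : V -> V) (E : submodClosed V) N :
  linear_between T E E -> linear_between (iter N T) E E.
Proof.
by move=> TE; elim: N => [|N IH]; [split|exact: linear_between_comp IH TE].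
Qed.

Lemma linear_between_parametrix (V : lmodType F) (T : V -> V) (E : submodClosed V) N :
  linear_between T E E -> linear_between (parametrix T N) E E.
Proof.
move=> TE; split=> [x xE|k x y xE yE]; rewrite /parametrix.
  by apply: rpred_sum => i _; have [+ _] := linear_between_iter V T E i TE; exact.
rewrite scaler_sumr -big_split; apply: eq_bigr => i _.
by have [_ ->] := linear_between_iter V T E i TE.
Qed.

(** Applying T^N to u = g + T u splits the remainder T^N u into T^N g, the next term of the sum, and
    the next remainder. *)
Lemma parametrix_formula (V : lmodType F) (T : V -> V) (E : submodClosed V)
    (u g : V) N :
  linear_between T E E -> g \in E -> u \in E -> u = g + T u ->
  u = parametrix T N g + iter N T u.
Proof.
move=> TE gE uE uT; elim: N => [|N IH]; first by rewrite /parametrix big_ord0 add0r.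
rewrite {1}IH /parametrix big_ord_recr -addrA; congr (_ + _).
have TN := linear_between_iter V T E N TE.
rewrite {1}uT (linear_betweenD _ _ _ _ _ _ _ TN)// -?iterSr//.
by case: TE => + _; exact.
Qed.

End LinearBetween.

Theorem theorem3p2 (R : realType) (n : nat) (d : R)
  (F : fieldType) (V W : lmodType F)
  (S DA DN : set (param R n))
  (X : param R n -> submodClosed V) (Y : param R n -> submodClosed W)
  (A : V -> W) (At : W -> V) (NN : V -> W)
  (DB : param R n -> V -> set (param R n))
  (B : param R n -> V -> V -> W)
  (delta : param R n -> param R n -> R)
  (hI : embeddings X S)
  (hII : regularising_parametrix d X Y S DA A At)
  (hIII : linearisation d X Y S DN NN DB B delta)
  (hIV : connected_domains X DA DN DB)
  (hV : delta_positive X DA DN DB delta)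
  (a0 : param R n) (u : V) (ha0 : (DA `&` DN) a0) (hu : u \in X a0) :
  let Du := DA `&` DB a0 u in
  let T := At \o B a0 u in
  ((forall (N : nat) (a : param R n), Du a ->
      linear_between (parametrix T N) (X a) (X a)) /\
   (forall a' a'' : param R n, Du a' -> Du a'' ->
      exists N' : nat, forall N : nat, (N' <= N)%N ->
        linear_between (iter N T) (X a') (X a''))) /\
  (forall (f : W) (b : param R n), Du b -> f \in Y (par_shift b (- d)) ->
     NN u \in Y (par_shift a0 (- d)) -> A u + NN u = f ->
     (forall N : nat,
        u = parametrix T N (At f + (u - At (A u))) + iter N T u) /\
     u \in X b).
Proof.
move=> Du T.
have [Spos Xsub] := hI; have [DAS Apar] := hII.
have [DAa0 DNa0] := ha0.
have [_ /(_ a0 u DNa0 hu)[DNB DBS NNu Blin]] := hIII.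
have [shiftD infD] := hV a0 u DNa0 hu.
(* [B a0 u] followed by [At] leads into X^(s+delta)_p, where [At] is available because (V) puts the
   shifted parameter in [DA]; an embedding then leads to X^c. *)
have step a c : Du a -> Du c ->
    `|nover n (par_p a) - nover n (par_p c)| < par_s a + delta a0 a - par_s c ->
    linear_between T (X a) (X c).
  move=> [DAa DBa] [DAc _] ac; have DAs := shiftD a (conj DAa DBa).
  apply: (@linear_between_sub _ _ _ _ _ (X (par_shift a (delta a0 a)))).
    apply: Xsub; [exact: DAS|exact: DAS|apply: embeds_of_lt => //].
      exact/Spos/DAS.
    exact/Spos/DAS.
  apply: linear_between_comp (Blin a DBa) _.
  have -> : par_shift a (- d + delta a0 a) = par_shift (par_shift a (delta a0 a)) (- d).
    by rewrite /par_shift /par_s /= -addrA [- d + _]addrC.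
  by have [] := Apar _ DAs.
have local a : Du a -> exists2 U, nbhs a U & forall b, Du b -> U b ->
    linear_between T (X a) (X b) /\ linear_between T (X b) (X a).
  move=> Da; have [e e0 He] := locally_bounded_below R (param R n) Du _ infD a Da.
  (* Within e/2, both s and n/p vary by less than e/2, while delta >= e at both points. Hence the
     variation of n/p stays below the gain in s in either direction. *)
  exists (ball a (e / 2)); first by apply: nbhsx_ballx; rewrite divr_gt0.
  move=> b Db ab; have ea : e <= delta a0 a by apply: He => //; exact: ballxx.
  have eb : e <= delta a0 b.
    by apply: He => //; apply: le_ball ab; rewrite ler_pdivrMr// ler_peMr ?ler1n// ltW.
  have abd : pdist a b < e / 2 := ab.
  have [/le_lt_trans/(_ abd) + /le_lt_trans/(_ abd)] := pdist_ge a b.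
  rewrite ltr_norml => /andP[s1 s2] nab.
  split; apply: step => //; first by apply: lt_trans nab _; lra.
  by rewrite distrC; apply: lt_trans nab _; lra.
have TX a : Du a -> linear_between T (X a) (X a).
  by move=> Da; have [U aU /(_ a Da (nbhs_singleton aU))[]] := local a Da.
have reach a b : Du a -> Du b -> exists N, linear_between (iter N T) (X a) (X b).
  apply: (connected_chain (param R n) Du
    (fun a b => exists N, linear_between (iter N T) (X a) (X b))).
  - exact: hIV.
  - move=> x y z [N xy] [M yz]; exists (M + N)%N.
    have -> : iter (M + N) T = iter M T \o iter N T by apply/funext => v; rewrite iterD.
    exact: linear_between_comp xy yz.
  - move=> x Dx; have [U xU Ur] := local x Dx; exists U => // y Dy Uy.
    by have [xy yx] := Ur y Dy Uy; split; exists 1%N.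
have far a b : Du a -> Du b -> exists N' : nat, forall N : nat, (N' <= N)%N ->
    linear_between (iter N T) (X a) (X b).
  move=> Da Db; have [N' ab] := reach a b Da Db; exists N' => N /subnKC <-.
  (* The surplus N - N' iterations come first and stay inside X^a. *)
  have -> : iter (N' + (N - N')) T = iter N' T \o iter (N - N') T.
    by apply/funext => v; rewrite iterD.
  exact: linear_between_comp (linear_between_iter _ _ _ _ (TX a Da)) ab.
split; first by split=> // N a Da; exact/linear_between_parametrix/TX.
move=> f b Db fY NY Auf.
have Da0 : Du a0 by split=> //; exact: DNB.
have [Alin Atlin Rreg] := Apar a0 DAa0.
have [AY _] := Alin; have [AtX _] := Atlin.
have fY0 : f \in Y (par_shift a0 (- d)) by rewrite -Auf rpredD ?AY.
have BY : B a0 u u \in Y (par_shift a0 (- d))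
  by rewrite -[B a0 u u]opprK -NNu -scaleN1r rpredZ.
(* [f] and [B a0 u u] = -N(u) lie in the same Y-space at [a0], so [At] splits over their sum A u. *)
have uT : u = At f + (u - At (A u)) + T u.
  have -> : A u = f - NN u by rewrite -Auf addrK.
  rewrite NNu opprK (linear_betweenD _ _ _ _ _ _ _ Atlin)// /T /=.
  by rewrite addrAC addrCA subrr addr0.
have gX : At f + (u - At (A u)) \in X a0 by rewrite rpredD ?AtX ?Rreg.
have formula N := parametrix_formula V T (X a0) u _ N (TX a0 Da0) gX hu uT.
(* For N large, T^N u lies in X^b. The other term does too: [At f] by the choice of data, R u
   because R regularises, and P^(N) preserves X^b. *)
split=> //; have [N /(_ N (leqnn N))[TNb _]] := far a0 b Da0 Db.
rewrite (formula N) rpredD ?TNb//.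
have [DAb _] := Db; have [_ [AtXb _] _] := Apar b DAb.
have [Pb _] := linear_between_parametrix V T (X b) N (TX b Db).
by rewrite Pb// rpredD ?AtXb ?Rreg.
Qed.
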